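(* The morphism $\Theta:\mathbf{H}_o\to\mathbf{PQSym}^{cop}$ is a morphism of $Dup$-$Dend$ bialgebras; that is, its restriction $(\mathbf{H}_o)_+\to\mathbf{PQSym}^{cop}_+$ to augmentation ideals is compatible with the products $.$ and $\nwarrow$ and the coproducts $\tilde\Delta_\prec$ and $\tilde\Delta_\succ$.
   Context: $K$ is a commutative field. A morphism of $Dup$-$Dend$ bialgebras is a linear map $\phi$ with $\phi(xy)=\phi(x)\phi(y)$, $\phi(x\nwarrow y)=\phi(x)\nwarrow\phi(y)$, $(\phi\otimes\phi)\circ\tilde\Delta_\prec=\tilde\Delta_\prec\circ\phi$ and $(\phi\otimes\phi)\circ\tilde\Delta_\succ=\tilde\Delta_\succ\circ\phi$, where the four operations on each side are as follows. **$(\mathbf{H}_o)_+$.** A rooted forest is a finite graph $F$ whose connected components are rooted trees; $V(F)$ is its vertex set. Edges are oriented from leaves to roots, and $v\twoheadrightarrow w$ means there is an oriented path from $v$ to $w$ (with $v\twoheadrightarrow v$). An ordered forest is a rooted forest with a total order on its vertices (up to isomorphism); if it has $n$ vertices, its vertex set is identified with $\{1,\ldots,n\}$ via the unique increasing bijection. $\mathbf{H}_o$ has basis the ordered forests, and $(\mathbf{H}_o)_+$ has basis the non-empty ones. $FG$ is the disjoint union, and $F\nwarrow G$ is obtained by grafting $G$ on the greatest vertex of $F$; in both cases the orders of $F$ and $G$ are kept and all vertices of $F$ are smaller than all vertices of $G$. A subset $\boldsymbol v\subseteq V(F)$ is an admissible cut if there are no two distinct $v,w\in\boldsymbol v$ with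 $v\twoheadrightarrow w$; $Lea_{\boldsymbol v}F$ is the sub-forest on $\{w:\exists v\in\boldsymbol v,\ w\twoheadrightarrow v\}$ and $Roo_{\boldsymbol v}F$ the sub-forest on the other vertices. With $g_F$ the greatest vertex of $F$, $\tilde\Delta_\prec(F)$ (resp. $\tilde\Delta_\succ(F)$) is the sum of $Lea_{\boldsymbol v}F\otimes Roo_{\boldsymbol v}F$ over the admissible cuts with $Lea_{\boldsymbol v}F$ and $Roo_{\boldsymbol v}F$ both non-empty and $g_F\in V(Lea_{\boldsymbol v}F)$ (resp. $g_F\in V(Roo_{\boldsymbol v}F)$). **$\mathbf{PQSym}^{cop}_+$.** A parking function of degree $n$ is a word $(a_1,\ldots,a_n)$ of $n$ positive integers whose nondecreasing rearrangement $(a'_1,\ldots,a'_n)$ satisfies $a'_i\le i$ for all $i$; it is viewed as a map from $\{1,\ldots,n\}$ to the positive integers. Permutations $\sigma\in\mathfrak{S}_n$, viewed as words $(\sigma(1)\ldots\sigma(n))$, are parking functions. $\mathbf{PQSym}_+$ has basis the parking functions of degree $\ge1$. For $\sigma=(a_1,\ldots,a_k)$, $\tau=(b_1,\ldots,b_l)$ put $\sigma\otimes\tau=(a_1,\ldots,a_k,b_1+k,\ldots,b_l+k)$. $Sh(k,l)$ is the set of permutations of $\{1,\ldots,k+l\}$ increasing on $\{1,\ldots,k\}$ and on $\{k+1,\ldots,k+l\}$. Let $m_\sigma$ be the maximal index $i$ such that $\sigma(i)$ is maximal. Then $$\sigma.\tau=\sum_{\zeta\in Sh(k,l)}(\sigma\otimes\tau)\circ\zeta^{-1},\qquad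 \sigma\nwarrow\tau=\sum_{\substack{\zeta\in Sh(k,l)\\ \zeta(k+1)\ge\zeta(m_\sigma)}}(\sigma\otimes\tau)\circ\zeta^{-1},$$ and for $\sigma$ of degree $n$, $$\tilde\Delta_\prec(\sigma)=\sum_{k=1}^{m_\sigma-1}\sigma_2^{(k)}\otimes\sigma_1^{(k)},\qquad \tilde\Delta_\succ(\sigma)=\sum_{k=m_\sigma}^{n-1}\sigma_2^{(k)}\otimes\sigma_1^{(k)},$$ where $\sigma_1^{(k)}$ and $\sigma_2^{(k)}$ are the parkizations of the words formed by the first $k$ and the last $n-k$ letters of $\sigma$. The parkization of a word $w=(w_1,\ldots,w_n)$ of positive integers is obtained as follows: let $d(w)$ be the smallest $i\ge1$ with $|\{j:w_j\le i\}|<i$; if $d(w)=n+1$, then $w$ is a parking function and is its own parkization; otherwise decrease by $1$ all letters greater than $d(w)$ and repeat. (On words with distinct letters it is the usual standardization.) **$\Theta$.** For an ordered forest $F$ with $n$ vertices, $S_F$ is the set of $\sigma\in\mathfrak{S}_n$ such that for all $1\le i,j\le n$, $i\twoheadrightarrow j$ in $F$ implies $\sigma^{-1}(i)\ge\sigma^{-1}(j)$; $\Theta(F)=\sum_{\sigma\in S_F}\sigma$, an element of $\mathbf{FQSym}\subseteq\mathbf{PQSym}$, where $\mathbf{FQSym}$ is the span of permutations. *)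

(* Defs.v *)
From HB Require Import structures.
From mathcomp Require Import all_boot all_order all_fingroup all_algebra.
From mathcomp Require Import zify.
From mathcomp.multinomials Require Export freeg.

Set Implicit Arguments.
Unset Strict Implicit.
Unset Printing Implicit Defensive.

Import GRing.Theory.
Local Open Scope ring_scope.

(* The tensor product of the vector spaces with bases S and T is modelled as  *)
(* the vector space with basis S * T.                                         *)

Section FreeModules.
Variable K : fieldType.

Definition bilift (S T : choiceType) (M : lmodType K) (f : S -> T -> M)
    (x : {freeg S / K}) (y : {freeg T / K}) : M :=
  fglift (fun s => fglift (f s) y) x.

Definition tensor (S T : choiceType) :
    {freeg S / K} -> {freeg T / K} -> {freeg (S * T)%type / K} :=
  bilift (fun s t => << (s, t) >>).

Definition tensor_map (S T S' T' : choiceType)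
    (f : {freeg S / K} -> {freeg S' / K}) (g : {freeg T / K} -> {freeg T' / K}) :
    {freeg (S * T)%type / K} -> {freeg (S' * T')%type / K} :=
  fglift (fun st => tensor (f << st.1 >>) (g << st.2 >>)).

End FreeModules.

(* A vector space with a graded basis, two products and two coproducts, all   *)
(* given on the basis. The Dup-Dend operations live on the augmentation       *)
(* ideal, spanned by the basis elements of positive degree; the values of the *)
(* fields on basis elements of degree 0 are irrelevant.                       *)
Record dupDend_data (K : fieldType) := DupDendData {
  dd_basis :> choiceType;
  dd_degree : dd_basis -> nat;
  dd_mul : dd_basis -> dd_basis -> {freeg dd_basis / K};
  dd_nwarrow : dd_basis -> dd_basis -> {freeg dd_basis / K};
  dd_prec : dd_basis -> {freeg (dd_basis * dd_basis)%type / K};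
  dd_succ : dd_basis -> {freeg (dd_basis * dd_basis)%type / K}
}.

Section DupDend.
Variables (K : fieldType).

Section Operations.
Variable A : dupDend_data K.
Implicit Types x y : {freeg A / K}.

Definition augmentation_ideal x : Prop :=
  forall b : A, b \in dom x -> (0 < dd_degree b)%N.

Definition ddmul x y := bilift (@dd_mul K A) x y.
Definition nwarrow x y := bilift (@dd_nwarrow K A) x y.
Definition Delta_prec x := fglift (@dd_prec K A) x.
Definition Delta_succ x := fglift (@dd_succ K A) x.

End Operations.

Record dupDend_morphism (A B : dupDend_data K)
    (phi : {freeg A / K} -> {freeg B / K}) : Prop := DupDendMorphism {
  ddm_linear : linear phi;
  ddm_augmentation : forall x, augmentation_ideal x -> augmentation_ideal (phi x);
  ddm_mul : forall x y, augmentation_ideal x -> augmentation_ideal y ->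
    phi (ddmul x y) = ddmul (phi x) (phi y);
  ddm_nwarrow : forall x y, augmentation_ideal x -> augmentation_ideal y ->
    phi (nwarrow x y) = nwarrow (phi x) (phi y);
  ddm_prec : forall x, augmentation_ideal x ->
    tensor_map phi phi (Delta_prec x) = Delta_prec (phi x);
  ddm_succ : forall x, augmentation_ideal x ->
    tensor_map phi phi (Delta_succ x) = Delta_succ (phi x)
}.

End DupDend.

(* The isomorphism class of an ordered forest with n vertices is encoded by   *)
(* the parent map on 'I_n (None at the roots); the order of the vertices is   *)
(* that of 'I_n, so that vertices are numbered from 0.                        *)

Definition edge n (p : {ffun 'I_n -> option 'I_n}) : rel 'I_n :=
  fun v w => p v == Some w.

Definition acyclic n (p : {ffun 'I_n -> option 'I_n}) : bool :=
  [forall v, forall w, edge p v w ==> ~~ connect (edge p) w v].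

Record oforest := OForest {
  of_val : {n : nat & {ffun 'I_n -> option 'I_n}};
  _ : acyclic (tagged of_val)
}.

HB.instance Definition _ := [isSub for of_val].
HB.instance Definition _ := [Choice of oforest by <:].

Definition nvert (F : oforest) : nat := tag (of_val F).

Definition parent (F : oforest) : {ffun 'I_(nvert F) -> option 'I_(nvert F)} :=
  tagged (of_val F).

Lemma parent_acyclic (F : oforest) : acyclic (parent F).
Proof. by case: F. Qed.

Definition mk_oforest n (p : {ffun 'I_n -> option 'I_n}) (Hp : acyclic p) :
    oforest :=
  @OForest (Tagged (fun n => {ffun 'I_n -> option 'I_n}) p) Hp.

Definition reaches (F : oforest) : rel 'I_(nvert F) := connect (edge (parent F)).

Definition greatest (F : oforest) : option 'I_(nvert F) :=
  [pick v : 'I_(nvert F) | [forall w : 'I_(nvert F), w <= v]%N].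

(* The vertices of F followed by those of G, the roots of G being attached to *)
(* r if r is a vertex of F, and remaining roots if r = None.                  *)
Definition join_parent (F G : oforest) (r : option 'I_(nvert F)) :
    {ffun 'I_(nvert F + nvert G) -> option 'I_(nvert F + nvert G)} :=
  [ffun v => match split v with
   | inl a => omap (@lshift (nvert F) (nvert G)) (parent F a)
   | inr b => if parent G b is Some c then Some (rshift (nvert F) c)
              else omap (@lshift (nvert F) (nvert G)) r
   end].

Lemma connect_acyclic n (p : {ffun 'I_n -> option 'I_n}) :
  (exists h : 'I_n -> nat, forall v w, edge p v w -> (h w < h v)%N) -> acyclic p.
Proof.
case=> h Hh; apply/'forall_forallP => v w; apply/implyP => evw.
apply/negP => /connectP[s Hs Ev].
suff: (h v <= h w)%N by rewrite leqNgt Hh.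
rewrite {}Ev {evw v}; elim: s w Hs => //= a s IH w /andP[/Hh wa /IH Ha].
exact: leq_trans Ha (ltnW wa).
Qed.

Lemma acyclic_height n (p : {ffun 'I_n -> option 'I_n}) : acyclic p ->
  exists h : 'I_n -> nat, forall v w, edge p v w -> (h w < h v)%N.
Proof.
move=> /'forall_forallP Hp; exists (fun v => #|[pred w | connect (edge p) v w]|).
move=> v w evw; apply/proper_card/properP; split.
  by apply/subsetP => u; rewrite !inE; apply/connect_trans/connect1.
exists v; rewrite !inE ?connect0 //.
by have /implyP/(_ evw) := Hp v w.
Qed.

Lemma join_acyclic (F G : oforest) r : acyclic (@join_parent F G r).
Proof.
have [hF HF] := acyclic_height (parent_acyclic F).
have [hG HG] := acyclic_height (parent_acyclic G).
pose M := (\max_v hF v).+1.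
apply: connect_acyclic.
exists (fun v => match split v with inl a => hF a | inr b => M + hG b end)%N.
move=> v w; rewrite /edge ffunE.
case: (split v) => [a|b].
  case Ea: (parent F a) => [c|] //= /eqP[<-].
  by rewrite (unsplitK (inl c)) HF // /edge Ea.
case Eb: (parent G b) => [c|] /=.
  by move=> /eqP[<-]; rewrite (unsplitK (inr c)) ltn_add2l HG // /edge Eb.
case: r => //= c /eqP[<-]; rewrite (unsplitK (inl c)).
by apply: leq_trans (leq_addr _ _); rewrite ltnS leq_bigmax.
Qed.

Definition oforest_join F G r := mk_oforest (@join_acyclic F G r).

Definition disjoint_union (F G : oforest) : oforest := @oforest_join F G None.

Definition graft (F G : oforest) : oforest := @oforest_join F G (greatest F).

(* enum_val : 'I_#|A| -> 'I_n is the increasing enumeration of A.             *)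
Definition sub_parent (F : oforest) (A : {set 'I_(nvert F)}) :
    {ffun 'I_#|A| -> option 'I_#|A|} :=
  [ffun k => [pick l : 'I_#|A| | edge (parent F) (enum_val k) (enum_val l)]].

Lemma sub_acyclic (F : oforest) A : acyclic (@sub_parent F A).
Proof.
have [h Hh] := acyclic_height (parent_acyclic F).
apply: connect_acyclic; exists (fun k => h (enum_val k)) => k l.
rewrite /edge ffunE; case: pickP => // l' El' /eqP[<-]; exact: Hh.
Qed.

Definition sub_forest (F : oforest) (A : {set 'I_(nvert F)}) : oforest :=
  mk_oforest (@sub_acyclic F A).

Definition admissible_cut (F : oforest) (v : {set 'I_(nvert F)}) : bool :=
  [forall x in v, forall y in v, (x != y) ==> ~~ reaches x y].

Definition Lea (F : oforest) (v : {set 'I_(nvert F)}) : {set 'I_(nvert F)} :=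
  [set w | [exists x in v, reaches w x]].

Definition Roo (F : oforest) (v : {set 'I_(nvert F)}) : {set 'I_(nvert F)} :=
  ~: Lea v.

Definition has_greatest (F : oforest) (A : {set 'I_(nvert F)}) : bool :=
  if greatest F is Some g then g \in A else false.

Section Ho.
Variable K : fieldType.

Definition oforest_prec (F : oforest) : {freeg (oforest * oforest)%type / K} :=
  \sum_(v : {set 'I_(nvert F)} |
        [&& admissible_cut v, Lea v != set0, Roo v != set0 & has_greatest (Lea v)])
    << (sub_forest (Lea v), sub_forest (Roo v)) >>.

Definition oforest_succ (F : oforest) : {freeg (oforest * oforest)%type / K} :=
  \sum_(v : {set 'I_(nvert F)} |
        [&& admissible_cut v, Lea v != set0, Roo v != set0 & has_greatest (Roo v)])
    << (sub_forest (Lea v), sub_forest (Roo v)) >>.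

Definition Ho : dupDend_data K := {|
  dd_basis := oforest;
  dd_degree := nvert;
  dd_mul := fun F G => << disjoint_union F G >>;
  dd_nwarrow := fun F G => << graft F G >>;
  dd_prec := oforest_prec;
  dd_succ := oforest_succ
|}.

End Ho.

Section Words.
Local Open Scope nat_scope.
Implicit Types (w : seq nat) (i k l n : nat).

(* Positions in words are numbered from 1.                                    *)
Definition letter w i : nat := nth 0 w i.-1.

Definition positive w : bool := all (leq 1) w.

Definition is_parking w : bool :=
  positive w && [forall i : 'I_(size w), letter (sort leq w) i.+1 <= i.+1].

Record parking := Parking {
  pf_word :> seq nat;
  _ : is_parking pf_word
}.

HB.instance Definition _ := [isSub for pf_word].
HB.instance Definition _ := [Choice of parking by <:].

Lemma parkingP (u : parking) : is_parking u.
Proof. by case: u. Qed.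

Lemma pf_positive (u : parking) : positive u.
Proof. by case/andP: (parkingP u). Qed.

Lemma nth_sorted_count (s : seq nat) c i : sorted leq s -> i < size s ->
  (nth 0 s i <= c) = (i < count (fun a => a <= c) s).
Proof.
elim: s i => // a s IH i /= pa.
have ss := path_sorted pa.
case: (leqP a c) => ac.
  by case: i => [|i] /= Hi; [rewrite ac | rewrite add1n ltnS IH].
move=> Hi.
have Ha : all (fun b => c < b) (a :: s).
  rewrite /= ac; apply/allP => b bs.
  have /allP/(_ b bs) ab := order_path_min leq_trans pa.
  exact: leq_trans ac ab.
have -> : count (fun b => b <= c) s = 0.
  apply/eqP; rewrite -leqn0 leqNgt -has_count; apply/hasPn => b bs.
  by rewrite -ltnNge; move/allP: Ha; apply; rewrite inE bs orbT.
rewrite addn0 ltn0; apply/negbTE; rewrite -ltnNge.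
have /allP := Ha; apply; exact: mem_nth.
Qed.

Lemma is_parkingP w :
  reflect (positive w /\ forall i, i <= size w -> i <= count (fun a => a <= i) w)
          (is_parking w).
Proof.
have cs i : count (fun a => a <= i) (sort leq w) = count (fun a => a <= i) w.
  by apply/seq.permP; rewrite perm_sort.
have ss : sorted leq (sort leq w) by apply: sort_sorted; exact: leq_total.
apply: (iffP andP) => -[pw H]; split=> //.
  case=> // i Hi; move/forallP/(_ (Ordinal Hi)): H.
  by rewrite /letter /= nth_sorted_count ?size_sort // cs.
apply/forallP => i; rewrite /letter /= nth_sorted_count ?size_sort // cs.
exact: H.
Qed.

Lemma perm_parking w1 w2 : perm_eq w1 w2 -> is_parking w1 -> is_parking w2.
Proof.
move=> e12 /is_parkingP[p1 H1]; apply/is_parkingP; split.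
  by rewrite /positive -(perm_all _ e12).
by move=> i; rewrite -(perm_size e12) -(seq.permP e12); apply: H1.
Qed.

Definition perm_word n (s : 'S_n) : seq nat := [seq (s i).+1 | i : 'I_n].

Lemma perm_eq_perm_word n (s : 'S_n) : perm_eq (iota 1 n) (perm_word s).
Proof.
apply: uniq_perm; rewrite ?iota_uniq //.
  by rewrite /perm_word /image_mem map_inj_uniq ?enum_uniq // => i j [] /val_inj/perm_inj.
move=> a; rewrite mem_iota; apply/idP/mapP => [|[i _ ->]]; last by rewrite add1n !ltnS /=.
case: a => // a; rewrite add1n !ltnS /= => Ha.
by exists ((s^-1)%g (Ordinal Ha)); rewrite ?mem_enum // permKV.
Qed.

Lemma perm_word_parking n (s : 'S_n) : is_parking (perm_word s).
Proof.
apply: perm_parking (perm_eq_perm_word s) _.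
apply/andP; split; first by apply/allP => a; rewrite mem_iota => /andP[].
have -> : sort leq (iota 1 n) = iota 1 n.
  by apply: sorted_sort; [exact: leq_trans | exact: iota_sorted].
apply/forallP => -[i /= Hi]; rewrite size_iota in Hi.
by rewrite /letter nth_iota.
Qed.

Definition parking_of_perm n (s : 'S_n) : parking := Parking (perm_word_parking s).

Definition shifted_cat (u v : seq nat) : seq nat := u ++ [seq b + size u | b <- v].

Lemma shifted_cat_parking (u v : parking) : is_parking (shifted_cat u v).
Proof.
have /is_parkingP[pu Hu] := parkingP u; have /is_parkingP[pv Hv] := parkingP v.
apply/is_parkingP; split.
  rewrite /positive all_cat all_map; apply/andP; split; first exact: pu.
  by apply/allP => b /(allP (pv : all _ _)) /=; lia.
move=> i; rewrite size_cat size_map count_cat count_map => Hi.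
case: (leqP i (size u)) => iu; first exact: leq_trans (Hu _ iu) (leq_addr _ _).
have -> : count (fun a => a <= i) u = size u.
  apply/eqP; rewrite eqn_leq count_size /=.
  apply: leq_trans (Hu _ (leqnn _)) _.
  by apply: sub_count => a /= Ha; apply: leq_trans Ha (ltnW iu).
have /Hv : i - size u <= size v by lia.
rewrite (@eq_count _ _ (preim (addn^~ (size u)) (fun a => a <= i))); first by lia.
by move=> a /=; lia.
Qed.

Definition shuffle k l (z : 'S_(k + l)) : bool :=
  [forall i : 'I_(k + l), forall j : 'I_(k + l),
     (i < j) && ((j < k) || (k <= i)) ==> (z i < z j)].

(* (u (x) v) o z^-1 as a word, composition being that of maps.                *)
Definition shuffle_word (u v : seq nat) (z : 'S_(size u + size v)) : seq nat :=
  [seq letter (shifted_cat u v) a | a <- perm_word (z^-1)%g].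

Lemma shuffle_word_parking (u v : parking) z : is_parking (@shuffle_word u v z).
Proof.
apply: perm_parking (shifted_cat_parking u v).
rewrite /shuffle_word; set w := shifted_cat u v.
have Ew : w = map (letter w) (iota 1 (size u + size v)).
  rewrite -[LHS](mkseq_nth 0) /mkseq (iotaDl 1 0) -map_comp.
  by rewrite /w {2}/shifted_cat size_cat size_map; apply: eq_map => i /=.
by rewrite {1}Ew; apply: perm_map; exact: perm_eq_perm_word.
Qed.

Definition shuffle_parking (u v : parking) (z : 'S_(size u + size v)) : parking :=
  Parking (shuffle_word_parking z).

(* m_w: the greatest position (numbered from 1) of the greatest letter.       *)
Definition max_pos w : nat :=
  \max_(i < size w | letter w i.+1 == \max_(a <- w) a) i.+1.

Lemma park_d_ex w : exists i, (1 <= i) && (count (fun a => a <= i) w < i).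
Proof. by exists (size w).+1; rewrite /= ltnS count_size. Qed.

Definition park_d w : nat := ex_minn (park_d_ex w).

Definition park_step w : seq nat :=
  if park_d w == (size w).+1 then w
  else [seq if park_d w < a then a.-1 else a | a <- w].

(* Each nontrivial step decreases the sum of the letters, so that the process *)
(* has reached a parking function after sumn w steps (see parkize_parking).   *)
Definition parkize w : seq nat := iter (sumn w) park_step w.

Lemma park_d_le w : park_d w <= (size w).+1.
Proof.
rewrite /park_d; case: ex_minnP => d _; apply.
by rewrite /= ltnS count_size.
Qed.

Lemma parking_park_d w :
  positive w -> is_parking w = (park_d w == (size w).+1).
Proof.
move=> pw; have := park_d_le w; rewrite /park_d; case: ex_minnP => d /andP[d0 Hd] md dn.
apply/is_parkingP/eqP => [[_ H]|Ed].
  apply/eqP; rewrite eqn_leq dn /= ltnNge; apply/negP => /H; lia.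
split=> // i Hi; rewrite leqNgt; apply/negP => Hc.
by have := md i; rewrite Hc andbT (leq_ltn_trans _ Hc) // => /(_ isT); lia.
Qed.

Lemma size_park_step w : size (park_step w) = size w.
Proof. by rewrite /park_step; case: ifP => // _; rewrite size_map. Qed.

Lemma park_step_positive w : positive w -> positive (park_step w).
Proof.
rewrite /park_step /park_d; case: ex_minnP => d /andP[d0 _] _.
case: ifP => // _ /allP pw; rewrite /positive all_map.
by apply/allP => a /pw /=; case: ifP; lia.
Qed.

Lemma park_step_sumn w :
  park_d w != (size w).+1 -> sumn (park_step w) < sumn w.
Proof.
move=> nd; rewrite /park_step (negbTE nd); have := park_d_le w.
rewrite leq_eqVlt (negbTE nd) ltnS /=.
rewrite /park_d; case: ex_minnP => d /andP[d0 Hd] _ {nd} dn.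
have {Hd dn} : has (fun a => d < a) w.
  rewrite has_count -(leq_add2l (count (fun a => a <= d) w)).
  rewrite (@eq_count _ (fun a => d < a) (predC (fun a => a <= d))).
    by rewrite count_predC; lia.
  by move=> a /=; rewrite ltnNge.
have Hle s : sumn [seq if d < a then a.-1 else a | a <- s] <= sumn s.
  by elim: s => //= a s IH; apply: leq_add => //; case: ifP => // _; lia.
elim: w => //= a w IH; case: (ltnP d a) => /= da.
  by move=> _; have := Hle w; lia.
by move/IH; lia.
Qed.

Lemma iter_park_step w m : positive w -> sumn w <= m ->
  is_parking (iter m park_step w).
Proof.
elim: m w => [|m IH] w pw Hm; rewrite ?iterSr.
  by rewrite /= parking_park_d //; apply/negPn/negP => /park_step_sumn; lia.
have [e|/park_step_sumn Hs] := eqVneq (park_d w) (size w).+1; last first.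
  by apply: IH (park_step_positive pw) _; lia.
have Es : park_step w = w by rewrite /park_step e eqxx.
rewrite Es; have -> : iter m park_step w = w by elim: m {IH Hm} => //= m ->.
by rewrite parking_park_d // e.
Qed.

Lemma parkize_parking w : positive w -> is_parking (parkize w).
Proof. by move=> pw; apply: iter_park_step. Qed.

Lemma take_positive (u : parking) k : positive (take k u).
Proof. by have := pf_positive u; rewrite /positive -{1}(cat_take_drop k u) all_cat => /andP[]. Qed.

Lemma drop_positive (u : parking) k : positive (drop k u).
Proof. by have := pf_positive u; rewrite /positive -{1}(cat_take_drop k u) all_cat => /andP[]. Qed.

Definition park_take (u : parking) k : parking :=
  Parking (parkize_parking (take_positive u k)).

Definition park_drop (u : parking) k : parking :=
  Parking (parkize_parking (drop_positive u k)).

End Words.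

Section PQSym.
Variable K : fieldType.

Definition parking_mul (u v : parking) : {freeg parking / K} :=
  \sum_(z : 'S_(size u + size v) | shuffle z) << shuffle_parking z >>.

Definition parking_nwarrow (u v : parking) : {freeg parking / K} :=
  \sum_(z : 'S_(size u + size v) | shuffle z &&
        (letter (perm_word z) (max_pos u) <= letter (perm_word z) (size u).+1)%N)
    << shuffle_parking z >>.

Definition parking_prec (u : parking) : {freeg (parking * parking)%type / K} :=
  \sum_(1 <= k < max_pos u) << (park_drop u k, park_take u k) >>.

Definition parking_succ (u : parking) : {freeg (parking * parking)%type / K} :=
  \sum_(max_pos u <= k < size u) << (park_drop u k, park_take u k) >>.

Definition PQSym_cop : dupDend_data K := {|
  dd_basis := parking;
  dd_degree := fun u => size u;
  dd_mul := parking_mul;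
  dd_nwarrow := parking_nwarrow;
  dd_prec := parking_prec;
  dd_succ := parking_succ
|}.

Definition S_forest (F : oforest) : {set 'S_(nvert F)} :=
  [set s : 'S_(nvert F) | [forall i, forall j,
     reaches i j ==> ((s^-1)%g j <= (s^-1)%g i)%N]].

Definition Theta : {freeg (Ho K) / K} -> {freeg PQSym_cop / K} :=
  fglift (fun F : oforest =>
    \sum_(s in S_forest F) << parking_of_perm s >> : {freeg parking / K}).

End PQSym.

(* Main.v *)
From HB Require Import structures.
Require Import Defs.
From mathcomp Require Import all_boot all_order all_fingroup all_algebra.
From mathcomp Require Import zify.
From mathcomp.multinomials Require Import freeg.

(* All operations being linear, everything is checked on basis elements. The  *)
(* word of s is in S_F iff every vertex occurs after its parent.              *)
(* Products: a word w in the letters 1..n+m is a shuffle of u and v + n for   *)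
(* the unique u, v + n obtained by keeping the letters <= n, resp. > n, and   *)
(* the parent condition for FG is that of F on u together with that of G on   *)
(* v. Grafting G on the vertex n of F adds the condition that the letters     *)
(* > n occur after n, and it suffices to know this for the first of them.     *)
(* Coproducts: v |-> Lea v is a bijection from the admissible cuts to the     *)
(* down-closed sets A of vertices. The words of S_F whose last #|A| letters   *)
(* are those of A are the concatenations of a linear extension of the         *)
(* complement of A and one of A, and parkization, being standardization on    *)
(* words with distinct letters, recovers the two factors.                     *)

Set Implicit Arguments.
Unset Strict Implicit.
Unset Printing Implicit Defensive.

Import GRing.Theory.

(** * Linear maps on free modules *)

(** A permutation word lies in $S_F$ exactly when it is a linear extension of F, parents before
    children ([S_forestE]), so [Theta] sums linear extensions. Linearity and bilinearity reduce
    every identity to basis forests, where sums without repeated terms are compared through their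
    sets of terms ([eq_sum_image]).

    Products: FG and the grafting are both joins, differing only in where the roots of G are
    attached. A linear extension of a join restricts to linear extensions of F and of G, and every
    shuffle of two such words that meets the constraint at the attachment vertex arises in this way
    ([join_lin_ext], [Theta_join]). Shuffling permutations correspond to these words by
    [sum_shuffles], and [nwarrow_shuffleE] identifies the condition on $\zeta$ with the grafting
    constraint.

    Coproducts: a linear extension cut after position k has a down-closed set A as its last letters.
    For fixed A the two pieces are independent linear extensions of the complement and of A
    ([glue_lin_ext], [sum_deconcat_dropset]), and summing over A recovers all admissible cuts
    ([Theta_cuts]). The side of the cut on which the greatest letter falls separates the two
    coproducts ([dropset_Lea_Roo]). *)

Section LinearExtension.
Local Open Scope ring_scope.
Variable K : fieldType.

Lemma fglift_dom (S : choiceType) (M : lmodType K) (f : S -> M) (x : {freeg S / K}) :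
  fglift f x = \sum_(s <- dom x) coeff s x *: f s.
Proof. by rewrite -[x in LHS]Freeg_dom fglift_Freeg /prelift big_map. Qed.

Lemma fgliftB (S : choiceType) (M : lmodType K) (f : S -> M) : zmod_morphism (fglift f).
Proof. exact: lift_is_additive. Qed.

HB.instance Definition _ (S : choiceType) (M : lmodType K) (f : S -> M) :=
  GRing.isZmodMorphism.Build {freeg S / K} M (fglift f) (fgliftB f).

Lemma fgliftZ (S : choiceType) (M : lmodType K) (f : S -> M) : scalable (fglift f).
Proof.
move=> a x; rewrite {1}/GRing.scale /= /fgscale raddf_sum /= fglift_dom scaler_sumr.
by apply: eq_bigr => s _; rewrite liftU scalerA.
Qed.

HB.instance Definition _ (S : choiceType) (M : lmodType K) (f : S -> M) :=
  GRing.isScalable.Build K {freeg S / K} M *:%R (fglift f) (fgliftZ f).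

Lemma fgliftU (S : choiceType) (M : lmodType K) (f : S -> M) s :
  fglift f << s >> = f s.
Proof. by rewrite liftU scale1r. Qed.

Lemma linear_fglift (S : choiceType) (M N : lmodType K) (f : S -> M)
    (phi : {linear M -> N}) x :
  phi (fglift f x) = fglift (phi \o f) x.
Proof. by rewrite !fglift_dom linear_sum; apply: eq_bigr => s _; rewrite linearZ. Qed.

Lemma eq_in_fglift (S : choiceType) (M : lmodType K) (f g : S -> M) x :
  {in dom x, f =1 g} -> fglift f x = fglift g x.
Proof. by move=> e; rewrite !fglift_dom; apply: eq_big_seq => s /e ->. Qed.

Lemma bilift_sum (S T : choiceType) (M : lmodType K) (f : S -> T -> M)
    I J (r : seq I) (r' : seq J) (P : pred I) (Q : pred J) (a : I -> S) (b : J -> T) :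
  bilift f (\sum_(i <- r | P i) << a i >>) (\sum_(j <- r' | Q j) << b j >>) =
  \sum_(i <- r | P i) \sum_(j <- r' | Q j) f (a i) (b j).
Proof.
rewrite /bilift linear_sum /=; apply: eq_bigr => i _; rewrite fgliftU linear_sum /=.
by apply: eq_bigr => j _; rewrite fgliftU.
Qed.

(** Linearity of [bilift] in its first argument is built into the definition; in the second it comes
    from exchanging two finite sums. With [linear_bilift], this reduces compatibility with a product
    to pairs of basis elements. *)
Lemma bilift_fglift (S T S' T' : choiceType) (M : lmodType K) (f : S' -> T' -> M)
    (g : S -> {freeg S' / K}) (h : T -> {freeg T' / K}) x y :
  bilift f (fglift g x) (fglift h y) = bilift (fun s t => bilift f (g s) (h t)) x y.
Proof.
rewrite /bilift linear_fglift /=; apply: eq_in_fglift => s _ /=.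
have -> : fglift (fun s' => fglift (f s') (fglift h y)) (g s) =
          \sum_(s' <- dom (g s)) \sum_(t <- dom y)
             coeff s' (g s) *: (coeff t y *: fglift (f s') (h t)).
  rewrite fglift_dom; apply: eq_bigr => s' _.
  rewrite (linear_fglift h (fglift (f s'))) (fglift_dom _ y) scaler_sumr.
  by [].
rewrite fglift_dom exchange_big /=; apply: eq_bigr => t _.
rewrite fglift_dom scaler_sumr; apply: eq_bigr => s' _.
by rewrite !scalerA mulrC.
Qed.

Lemma linear_bilift (S T : choiceType) (M N : lmodType K) (f : S -> T -> M)
    (phi : {linear M -> N}) x y :
  phi (bilift f x y) = bilift (fun s t => phi (f s t)) x y.
Proof.
rewrite /bilift linear_fglift; apply: eq_in_fglift => s _ /=.
exact: linear_fglift.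
Qed.

(** Restricting to supports is what lets the augmentation hypothesis supply non-empty forests. *)
Lemma eq_in_bilift (S T : choiceType) (M : lmodType K) (f g : S -> T -> M) x y :
  {in dom x & dom y, f =2 g} -> bilift f x y = bilift g x y.
Proof. by move=> e; apply: eq_in_fglift => s xs; apply: eq_in_fglift => t /e ->. Qed.

End LinearExtension.

(** By injectivity, [f] and [g] list the same set of keys, each key once. The summand depends on the
    key alone, and [F] itself may be any map. *)
Lemma eq_sum_image (V : nmodType) (T : eqType) (F : T -> V) (I J : finType)
    (P : pred I) (Q : pred J) (f : I -> T) (g : J -> T) :
    {in P &, injective f} -> {in Q &, injective g} ->
    (forall i, P i -> exists2 j, Q j & g j = f i) ->
    (forall j, Q j -> exists2 i, P i & f i = g j) ->
  (\sum_(i | P i) F (f i) = \sum_(j | Q j) F (g j))%R.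
Proof.
move=> fI gI fg gf.
have Ef : (\sum_(i | P i) F (f i) = \sum_(t <- [seq f i | i <- enum P]) F t)%R.
  by rewrite big_map big_enum.
have Eg : (\sum_(j | Q j) F (g j) = \sum_(t <- [seq g j | j <- enum Q]) F t)%R.
  by rewrite big_map big_enum.
rewrite Ef Eg; apply/perm_big/uniq_perm.
- by rewrite map_inj_in_uniq ?enum_uniq // => i j; rewrite !mem_enum; apply: fI.
- by rewrite map_inj_in_uniq ?enum_uniq // => i j; rewrite !mem_enum; apply: gI.
move=> t; apply/mapP/mapP => -[i]; rewrite mem_enum => Hi ->.
  by have [j Hj E] := fg i Hi; exists j; rewrite ?mem_enum.
by have [j Hj E] := gf i Hi; exists j; rewrite ?mem_enum.
Qed.

Local Open Scope nat_scope.

(** * Words of permutations and shuffles *)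

Section PermWords.
Variable n : nat.
Implicit Types (s : 'S_n) (w : seq nat).

Lemma size_perm_word s : size (perm_word s) = n.
Proof. by rewrite size_map size_enum_ord. Qed.

Lemma nth_perm_word s (i : 'I_n) : nth 0 (perm_word s) i = (s i).+1.
Proof. by rewrite (nth_map i) ?size_enum_ord // nth_ord_enum. Qed.

Lemma perm_word_inj : injective (@perm_word n).
Proof.
move=> s t est; apply/permP => i; apply/val_inj/succn_inj.
by rewrite /= -!nth_perm_word est.
Qed.

Lemma perm_word_iota s : perm_eq (perm_word s) (iota 1 n).
Proof. by rewrite perm_sym perm_eq_perm_word. Qed.

Lemma perm_word_uniq s : uniq (perm_word s).
Proof. by rewrite (perm_uniq (perm_word_iota s)) iota_uniq. Qed.

Lemma mem_perm_word s a : (a \in perm_word s) = (0 < a <= n).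
Proof. by rewrite (perm_mem (perm_word_iota s)) mem_iota add1n ltnS. Qed.

Lemma perm_word_surj w : perm_eq w (iota 1 n) -> exists s, perm_word s = w.
Proof.
move=> pw; have sw : size w = n by rewrite (perm_size pw) size_iota.
have nw (i : 'I_n) : 0 < nth 0 w i <= n.
  have : nth 0 w i \in w by rewrite mem_nth ?sw.
  by rewrite (perm_mem pw) mem_iota add1n ltnS.
have lw (i : 'I_n) : (nth 0 w i).-1 < n by have := nw i; lia.
pose f i := Ordinal (lw i).
have fI : injective f.
  move=> i j /(congr1 val) /= e; apply/val_inj/eqP.
  rewrite -(@nth_uniq _ 0 w) ?sw ?ltn_ord ?(perm_uniq pw) ?iota_uniq //=.
  by have := nw i; have := nw j; lia.
exists (perm fI); apply: (@eq_from_nth _ 0); rewrite size_perm_word ?sw // => i Hi.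
rewrite (nth_perm_word _ (Ordinal Hi)) permE /=.
by have := nw (Ordinal Hi); rewrite /=; lia.
Qed.

(** Lets positions in words replace values of inverse permutations. *)
Lemma index_perm_word s (i : 'I_n) : index i.+1 (perm_word s) = (s^-1)%g i.
Proof.
have <- : nth 0 (perm_word s) ((s^-1)%g i) = i.+1 by rewrite nth_perm_word permKV.
by rewrite index_uniq ?perm_word_uniq ?size_perm_word.
Qed.

Lemma max_pos_perm_word s : 0 < n -> max_pos (perm_word s) = (index n (perm_word s)).+1.
Proof.
move=> n0; have nw : n \in perm_word s by rewrite mem_perm_word n0 leqnn.
have iw : index n (perm_word s) < size (perm_word s) by rewrite index_mem.
have -> : max_pos (perm_word s) = \max_(i < size (perm_word s) | i == Ordinal iw) i.+1.
  apply: eq_bigl => i.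
  have -> : \max_(a <- perm_word s) a = n.
    apply/eqP; rewrite eqn_leq (@leq_bigmax_seq _ _ xpredT id n nw) // andbT.
    by apply/bigmax_leqP_seq => a; rewrite mem_perm_word => /andP[].
  rewrite /letter /=; apply/eqP/eqP => [e | ->]; last exact: nth_index.
  by apply: val_inj; rewrite /= -[X in index X]e index_uniq ?perm_word_uniq.
by rewrite big_pred1_eq.
Qed.

End PermWords.

(** Deleting letters preserves the order of the others. An absent letter has the length of the word
    as its index, so it is covered too. *)
Lemma index_filter_leq (T : eqType) (p : pred T) (w : seq T) x y : p x -> p y ->
  (index x (filter p w) <= index y (filter p w)) = (index x w <= index y w).
Proof.
move=> px py; elim: w => //= a w IH; case: (boolP (p a)) => pa /=.
  by case: eqP => [//|_]; case: eqP => // _; rewrite !ltnS IH.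
have -> : (a == x) = false by apply: contraNF pa => /eqP->.
by have -> : (a == y) = false; [apply: contraNF pa => /eqP-> | rewrite ltnS IH].
Qed.

Section Shuffles.
Variables u v : seq nat.
Local Notation k := (size u).
Local Notation l := (size v).
Local Notation uv := (shifted_cat u v).
Implicit Types (z : 'S_(k + l)).

Lemma size_shifted_cat : size uv = k + l.
Proof. by rewrite size_cat size_map. Qed.

Lemma size_shuffle_word z : size (shuffle_word z) = k + l.
Proof. by rewrite size_map size_perm_word. Qed.

Lemma nth_shuffle_word z (i : 'I_(k + l)) : nth 0 (shuffle_word z) (z i) = nth 0 uv i.
Proof.
by rewrite (nth_map 0) ?size_perm_word // nth_perm_word permK.
Qed.

Lemma perm_shuffle_word z : perm_eq (shuffle_word z) uv.
Proof.
rewrite -[uv in X in perm_eq _ X](mkseq_nth 0) /mkseq size_shifted_cat.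
have -> : [seq nth 0 uv i | i <- iota 0 (k + l)] = map (letter uv) (iota 1 (k + l)).
  by rewrite (iotaDl 1 0) -map_comp.
by apply: perm_map; exact: perm_word_iota.
Qed.

Hypothesis uv_uniq : uniq uv.

Lemma shuffle_word_uniq z : uniq (shuffle_word z).
Proof. by rewrite (perm_uniq (perm_shuffle_word z)). Qed.

Lemma index_shuffle_word z (i : 'I_(k + l)) : index (nth 0 uv i) (shuffle_word z) = z i.
Proof.
by rewrite -(nth_shuffle_word z) index_uniq ?shuffle_word_uniq ?size_shuffle_word.
Qed.

Lemma shuffle_word_inj : injective (@shuffle_word u v).
Proof.
by move=> z t e; apply/permP => i; apply: val_inj; rewrite /= -!index_shuffle_word e.
Qed.

Hypothesis u_le : all (fun a => a <= k) u.
Hypothesis v_gt : all (leq 1) v.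

Lemma shuffle_word_sorted z (p : pred nat) :
  sorted (relpre (index^~ (shuffle_word z)) ltn) (filter p (shuffle_word z)).
Proof.
apply: sorted_filter => [a b c /= |]; first exact: ltn_trans.
apply/(sortedP 0) => i Hi /=.
by rewrite !index_uniq ?shuffle_word_uniq // ltnW.
Qed.

(** A filtered shuffle word is sorted by position in that word. The shuffle condition says that [u]
    and the shifted [v] are sorted in the same way, and strictly sorted lists with the same members
    are equal. *)
Lemma filter_shuffle_word z : shuffle z ->
  filter (fun a => a <= k) (shuffle_word z) = u /\
  filter (fun a => k < a) (shuffle_word z) = map (addn^~ k) v.
Proof.
move=> /'forall_forallP Hz; set w := shuffle_word z.
have zlt (i j : 'I_(k + l)) : i < j -> (j < k) || (k <= i) -> z i < z j.
  by move=> ij jk; have /implyP := Hz i j; rewrite ij jk; apply.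
have v_gtk a : a \in map (addn^~ k) v -> k < a.
  by move=> /mapP[b /(allP v_gt) b0 ->]; lia.
have mem_w a : (a \in w) = (a \in u) || (a \in map (addn^~ k) v).
  by rewrite (perm_mem (perm_shuffle_word z)) mem_cat.
have tr : transitive (relpre (index^~ w) ltn) by move=> a b c; apply: ltn_trans.
have ir : irreflexive (relpre (index^~ w) ltn) by move=> a; apply: ltnn.
split.
- apply: (irr_sorted_eq tr ir) (shuffle_word_sorted z _) _ _.
    apply/(sortedP 0) => i Hi /=.
    have Hi1 : i < k + l by lia.
    have Hi2 : i.+1 < k + l by lia.
    have := zlt (Ordinal Hi1) (Ordinal Hi2) (ltnSn _); rewrite Hi => /(_ isT).
    by rewrite -!index_shuffle_word !nth_cat Hi /= (ltnW Hi).
  move=> a; rewrite mem_filter mem_w.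
  case: (boolP (a \in u)) => [/(allP u_le) -> // | au] /=.
  by apply/negP => /andP[ak /v_gtk]; lia.
- apply: (irr_sorted_eq tr ir) (shuffle_word_sorted z _) _ _.
    apply/(sortedP 0) => i; rewrite size_map => Hi /=.
    have Hi1 : k + i < k + l by lia.
    have Hi2 : k + i.+1 < k + l by lia.
    have := zlt (Ordinal Hi1) (Ordinal Hi2); rewrite /= leq_addr orbT => /(_ _ isT) H.
    move: H; rewrite -!index_shuffle_word !nth_cat /= !ltnNge !leq_addr /=.
    by rewrite !addKn -ltnNge; apply; lia.
  move=> a; rewrite mem_filter mem_w.
  case: (boolP (a \in map _ v)) => [/v_gtk -> | av] /=; first by rewrite orbT.
  by rewrite orbF; apply/negP => /andP[ak /(allP u_le)]; lia.
Qed.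

(** The shuffle sends [i] to the position in [w] of the letter number [i] of [uv]. It increases on
    each block because filtering preserves relative order. *)
Lemma shuffle_word_surj w :
  filter (fun a => a <= k) w = u -> filter (fun a => k < a) w = map (addn^~ k) v ->
  exists2 z, shuffle z & @shuffle_word u v z = w.
Proof.
move=> fu fv.
have puv : perm_eq uv w.
  rewrite /shifted_cat -{1}fu -fv (@eq_filter _ (ltn k) (predC (fun a => a <= k))).
    by rewrite perm_filterC.
  by move=> a /=; rewrite ltnNge.
have uw : uniq w by rewrite -(perm_uniq puv).
have sw : size w = k + l by rewrite -(perm_size puv) size_shifted_cat.
have mw m : m < k + l -> nth 0 uv m \in w.
  by move=> Hm; rewrite -(perm_mem puv) mem_nth ?size_shifted_cat.
have lw (i : 'I_(k + l)) : index (nth 0 uv i) w < k + l.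
  by have := mw i (ltn_ord i); rewrite -index_mem sw.
pose f i := Ordinal (lw i).
have fI : injective f.
  move=> i j /(congr1 val) /= e; apply/val_inj/eqP.
  rewrite -(@nth_uniq _ 0 uv) ?size_shifted_cat ?ltn_ord //=.
  by rewrite -(nth_index 0 (mw i _)) // e nth_index ?mw.
have Ez i : perm fI i = index (nth 0 uv i) w :> nat by rewrite permE.
exists (perm fI).
  apply/'forall_forallP => i j; apply/implyP => /andP[ij /orP[jk|ki]].
    rewrite !Ez !nth_cat jk (ltn_trans ij jk) ltnNge.
    rewrite -(@index_filter_leq _ (fun a => a <= k)) ?fu.
    - by rewrite !index_uniq -?ltnNge ?(ltn_trans ij jk) //;
         move: uv_uniq; rewrite cat_uniq => /and3P[].
    - by apply: (allP u_le); rewrite mem_nth.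
    - by apply: (allP u_le); rewrite mem_nth // (ltn_trans ij jk).
  have il : i - k < l by have := ltn_ord i; lia.
  have jl : j - k < l by have := ltn_ord j; lia.
  have v_gtk m : m < l -> k < nth 0 [seq b + k | b <- v] m.
    by move=> Hm; rewrite (nth_map 0) // -[k in k < _]add0n ltn_add2r (allP v_gt) ?mem_nth.
  have [ik jk] : (i < k) = false /\ (j < k) = false by split; lia.
  rewrite !Ez !nth_cat ik jk ltnNge.
  rewrite -(@index_filter_leq _ (fun a => k < a)) ?fv ?v_gtk //.
  have uv2 : uniq [seq b + k | b <- v] by move: uv_uniq; rewrite cat_uniq => /and3P[].
  by rewrite !index_uniq ?size_map // -ltnNge; lia.
apply: (@eq_from_nth _ 0); rewrite size_shuffle_word ?sw // => m Hm.
have -> : m = perm fI ((perm fI)^-1%g (Ordinal Hm)) by rewrite permKV.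
rewrite nth_shuffle_word Ez nth_index //.
by rewrite -(perm_mem puv) mem_nth ?size_shifted_cat.
Qed.

End Shuffles.

(** * Parkization of words with distinct letters *)

(** By minimality of [d], at least [d - 1] letters are at most [d - 1]; if [d] occurred, at least
    [d] letters would be at most [d], against the choice of [d]. *)
Lemma park_d_notin w : uniq w -> park_d w \notin w.
Proof.
move=> uw; rewrite /park_d; case: ex_minnP => d /andP[d0 Hd] dmin.
apply/negP => dw.
have E : count (fun a => a <= d) w = count (fun a => a <= d.-1) w + count_mem d w.
  rewrite -count_predUI [X in _ = _ + X](@eq_count _ _ pred0) ?count_pred0 ?addn0.
    by apply: eq_count => a /=; lia.
  by move=> a /=; lia.
move: Hd; rewrite E count_uniq_mem // dw.
(* Minimality only concerns indices at least 1, so it cannot be applied to [d - 1] when [d = 1]. *)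
have [->|d1] := eqVneq d 1; first by rewrite addn1.
by have := dmin d.-1; case: ltnP; lia.
Qed.

(** Lowering the letters above [d] by one could only merge [d] and [d + 1], and [d] is not a
    letter. *)
Lemma park_step_mono w : uniq w ->
  exists2 h : nat -> nat, {in w &, {homo h : x y / x < y}} & park_step w = map h w.
Proof.
move=> uw; rewrite /park_step; case: eqP => _; first by exists id; rewrite ?map_id.
eexists; last by reflexivity.
move=> x y xw yw xy /=.
have xd : x != park_d w by apply: contraNneq (park_d_notin uw) => <-.
by case: (ltnP _ x); case: (ltnP _ y); lia.
Qed.

Lemma map_homo_uniq (w : seq nat) (h : nat -> nat) :
  {in w &, {homo h : x y / x < y}} -> uniq w -> uniq (map h w).
Proof.
move=> hm uw; rewrite map_inj_in_uniq // => x y xw yw e.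
have := hm y x yw xw; have := hm x y xw yw.
by rewrite e ltnn; case: ltngtP => // _ H1 H2; [have := H1 isT | have := H2 isT].
Qed.

Lemma parkize_mono w : uniq w ->
  exists2 h : nat -> nat, {in w &, {homo h : x y / x < y}} & parkize w = map h w.
Proof.
rewrite /parkize => uw; elim: (sumn w) => [|m [h hm IH]].
  by exists id; rewrite ?map_id.
rewrite iterS IH; have [g gm ->] := park_step_mono (map_homo_uniq hm uw).
exists (g \o h); last by rewrite map_comp.
by move=> x y xw yw xy; apply: gm; rewrite ?map_f ?hm.
Qed.

(** The parking condition at [i = size w] bounds all letters by [size w], and distinct positive
    letters then exhaust the interval. *)
Lemma parking_uniq_iota w : is_parking w -> uniq w -> perm_eq w (iota 1 (size w)).
Proof.
move=> /is_parkingP[pw Hw] uw; rewrite uniq_perm ?iota_uniq //.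
have sub : {subset w <= iota 1 (size w)}.
  move=> a aw; rewrite mem_iota add1n ltnS (allP (pw : all _ _) _ aw) /=.
  have : all (fun a => a <= size w) w.
    by rewrite all_count eqn_leq count_size Hw.
  by move/allP; apply.
by have [] := uniq_min_size uw sub; rewrite ?size_iota.
Qed.

(* For e increasing, the word on the letters e whose standardization is u.    *)
Definition expand (e u : seq nat) : seq nat := [seq nth 0 e a.-1 | a <- u].

Section Expand.
Variable e : seq nat.
Hypothesis e_sorted : sorted ltn e.

Let e_uniq : uniq e. Proof. exact: (sorted_uniq ltn_trans ltnn e_sorted). Qed.

Lemma expand_iota : expand e (iota 1 (size e)) = e.
Proof. by rewrite /expand (iotaDl 1 0) -map_comp -[RHS](mkseq_nth 0). Qed.

Lemma perm_expand u : perm_eq u (iota 1 (size e)) -> perm_eq (expand e u) e.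
Proof. by move=> pu; rewrite -[X in perm_eq _ X]expand_iota perm_map. Qed.

Lemma expand_surj w : perm_eq w e ->
  exists2 u, perm_eq u (iota 1 (size e)) & expand e u = w.
Proof.
move=> pw; exists [seq (index x e).+1 | x <- w].
  rewrite (perm_trans (perm_map _ pw)) //.
  rewrite (_ : [seq _ | x <- e] = iota 1 (size e)) //.
  apply: (@eq_from_nth _ 0); rewrite size_map ?size_iota // => i Hi.
  by rewrite (nth_map 0) // nth_iota // index_uniq.
rewrite /expand -map_comp map_id_in // => x xw /=.
by rewrite nth_index // -(perm_mem pw).
Qed.

Lemma expand_index u a : perm_eq u (iota 1 (size e)) -> a < size e ->
  index (nth 0 e a) (expand e u) = index a.+1 u.
Proof.
move=> pu ae.
have au : a.+1 \in u by rewrite (perm_mem pu) mem_iota.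
have iu : index a.+1 u < size u by rewrite index_mem.
have -> : nth 0 e a = nth 0 (expand e u) (index a.+1 u).
  by rewrite (nth_map 0) ?nth_index.
by rewrite index_uniq ?size_map // (perm_uniq (perm_expand pu)).
Qed.

(** Parkization relabels the letters increasingly, and its result, a parking function with distinct
    letters, uses exactly 1 to [size e]. So [H], expansion followed by this relabelling, is an
    increasing map of that interval onto itself, hence the identity. *)
Lemma parkize_expand u : positive e -> perm_eq u (iota 1 (size e)) ->
  parkize (expand e u) = u.
Proof.
move=> pe pu; have pw := perm_expand pu.
have uw : uniq (expand e u) by rewrite (perm_uniq pw).
have [h hm E] := parkize_mono uw; rewrite E /expand -map_comp.
set H := h \o _.
have EH : map H (iota 1 (size e)) = iota 1 (size e).
  apply: (irr_sorted_eq ltn_trans ltnn _ (iota_ltn_sorted _ _)).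
    rewrite (iotaDl 1 0) -map_comp; apply/(sortedP 0) => i.
    rewrite size_map size_iota => Hi.
    rewrite !(nth_map 0) ?size_iota // ?(ltnW Hi) // !nth_iota // ?(ltnW Hi) // /H /=.
    apply: hm; rewrite ?(perm_mem pw) ?mem_nth // ?(ltnW Hi) //.
    by move/(sortedP 0): e_sorted; apply.
  apply: perm_mem; apply: (@perm_trans _ (map H u)).
    by rewrite perm_map // perm_sym.
  have -> : map H u = parkize (expand e u) by rewrite E -map_comp.
  have -> : size e = size (parkize (expand e u)).
    by rewrite E !size_map (perm_size pu) size_iota.
  apply: parking_uniq_iota; last by rewrite E map_homo_uniq.
  by apply: parkize_parking; rewrite /positive (perm_all _ pw).
rewrite map_id_in // => a; rewrite (perm_mem pu) => ai.
have /(nth_index 0) <- := ai.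
have ia : index a (iota 1 (size e)) < size (iota 1 (size e)) by rewrite index_mem.
by rewrite -[RHS](congr1 (fun s => nth 0 s _) EH) (nth_map 0).
Qed.

End Expand.

(** * Linear extensions and products of forests *)

(** Only edges are tested, transitivity giving the rest. Arbitrary words are allowed, so that
    filtered and concatenated words need no underlying permutation. *)
Definition lin_ext n (p : {ffun 'I_n -> option 'I_n}) (w : seq nat) : bool :=
  [forall i : 'I_n, if p i is Some j then index j.+1 w <= index i.+1 w else true].

Lemma lin_extP n (p : {ffun 'I_n -> option 'I_n}) w :
  reflect (forall i j : 'I_n, p i = Some j -> index j.+1 w <= index i.+1 w)
          (lin_ext p w).
Proof.
apply: (iffP forallP) => H i; last by case E: (p i) => [j|//]; apply: H.
by move=> j E; have := H i; rewrite E.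
Qed.

Lemma S_forestE (F : oforest) s :
  (s \in S_forest F) = lin_ext (parent F) (perm_word s).
Proof.
rewrite inE; apply/idP/lin_extP => [/'forall_forallP H i j Eij | H].
  have /implyP := H i j; rewrite !index_perm_word; apply.
  by apply: connect1; rewrite /edge Eij.
apply/'forall_forallP => i j; apply/implyP => /connectP[q Hq ->].
elim: q i Hq => //= a q IH i /andP[/eqP /H]; rewrite !index_perm_word => ia /IH.
by move/leq_trans; apply.
Qed.

Lemma parking_of_perm_inj n : injective (@parking_of_perm n).
Proof. by move=> s t /(congr1 pf_word) /perm_word_inj. Qed.

Lemma greatestP (F : oforest) : 0 < nvert F ->
  exists2 g, greatest F = Some g & g.+1 = nvert F.
Proof.
move=> F0; have Hg : (nvert F).-1 < nvert F by lia.
rewrite /greatest; case: pickP => [g /forallP Hm | /(_ (Ordinal Hg)) /forallP []].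
  by exists g => //; have := Hm (Ordinal Hg); have := ltn_ord g => /=; lia.
by move=> w /=; have := ltn_ord w; lia.
Qed.

Section Join.
Variables (F G : oforest) (r : option 'I_(nvert F)).
Local Notation n := (nvert F).
Local Notation m := (nvert G).

(* The constraints on the word coming from the edges from roots of G to r. It *)
(* is harmless to impose them on all vertices of G.                           *)
Definition graft_ext (w : seq nat) : bool :=
  if r is Some c then [forall b : 'I_m, index c.+1 w <= index (n + b).+1 w]
  else true.

(** Edges inside F compare letters at most [n], edges inside G letters above [n], and filtering
    keeps both comparisons. The remaining edges join roots of G to [r]. *)
Lemma join_lin_ext (w u v : seq nat) :
    filter (fun a => a <= n) w = u ->
    filter (fun a => n < a) w = map (addn^~ n) v ->
  lin_ext (@join_parent F G r) w =
  [&& lin_ext (parent F) u, lin_ext (parent G) v & graft_ext w].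
Proof.
move=> Eu Ev.
have EF (i j : 'I_n) : (index j.+1 u <= index i.+1 u) = (index j.+1 w <= index i.+1 w).
  by rewrite -Eu index_filter_leq.
have EG (i j : 'I_m) :
    (index j.+1 v <= index i.+1 v) = (index (n + j).+1 w <= index (n + i).+1 w).
  have ix (a : 'I_m) : index a.+1 v = index (n + a).+1 (filter (fun a => n < a) w).
    by rewrite Ev -(index_map (@addIn n)) addSn addnC.
  by rewrite !ix index_filter_leq // ltnS leq_addr.
apply/lin_extP/and3P => [H | [/lin_extP HF /lin_extP HG HC] i j].
  have HG : lin_ext (parent G) v.
    apply/lin_extP => i j Eij; rewrite EG.
    by apply: (H (rshift n i) (rshift n j)); rewrite ffunE (unsplitK (inr i)) Eij.
  split=> //.
    apply/lin_extP => i j Eij; rewrite EF.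
    by apply: (H (lshift m i) (lshift m j)); rewrite ffunE (unsplitK (inl i)) Eij.
  rewrite /graft_ext; case Er: r => [c|//]; apply/forallP => b.
  have [h Hh] := acyclic_height (parent_acyclic G).
  (* Climbing from [b] to its parents lowers the height and never moves later in the word; it ends
     at a root of G, attached to [c]. *)
  elim: {b}(h b).+1 {-2}b (ltnSn (h b)) => // k IH b hb.
  case Eb: (parent G b) => [b'|].
    apply: (@leq_trans (index (n + b').+1 w)).
      by apply: IH; have := Hh b b'; rewrite /edge Eb eqxx => /(_ isT); lia.
    by rewrite -EG; move/lin_extP: HG; apply.
  apply: (H (rshift n b) (lshift m c)).
  by rewrite ffunE (unsplitK (inr b)) Eb Er.
case: (split_ordP i) => [a -> | b ->]; rewrite ffunE.
  rewrite (unsplitK (inl a)); case Ea: (parent F a) => [a'|//] [<-] /=.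
  by rewrite -EF; apply: HF.
rewrite (unsplitK (inr b)); case Eb: (parent G b) => [b'|] /=;
  first by case=> <- /=; rewrite -EG; apply: HG.
move: HC; rewrite /graft_ext; case: r => //= c /forallP HC [<-] /=.
exact: HC.
Qed.

End Join.

Section SumShuffles.
Variables (K : fieldType) (n m : nat).

Definition is_shuffle (s : 'S_n) (t : 'S_m) (w : seq nat) : bool :=
  (filter (fun a => a <= n) w == perm_word s) &&
  (filter (fun a => n < a) w == map (addn^~ n) (perm_word t)).

Lemma shifted_cat_perm_word (s : 'S_n) (t : 'S_m) :
  perm_eq (shifted_cat (perm_word s) (perm_word t)) (iota 1 (n + m)).
Proof.
rewrite iotaD perm_cat ?perm_word_iota // size_perm_word.
rewrite addnC iotaDl (eq_map (fun a => addnC a n)); apply: perm_map.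
exact: perm_word_iota.
Qed.

(** As [s] and [t] are permutations, the shuffled word has distinct letters and determines [z]. The
    predicate [C] accommodates both products. *)
Lemma sum_shuffles (s : 'S_n) (t : 'S_m) (C : pred (seq nat)) :
  (\sum_(z : 'S_(size (parking_of_perm s) + size (parking_of_perm t)) |
        shuffle z && C (shuffle_word z))
     << shuffle_parking z >> : {freeg parking / K})%R =
  (\sum_(x : 'S_(n + m) | is_shuffle s t (perm_word x) && C (perm_word x))
     << parking_of_perm x >>)%R.
Proof.
have su : size (parking_of_perm s) = n by rewrite /= size_perm_word.
have uv_iota := shifted_cat_perm_word s t.
have uv_uniq : uniq (shifted_cat (perm_word s) (perm_word t)).
  by rewrite (perm_uniq uv_iota) iota_uniq.
have ule : all (fun a => a <= size (perm_word s)) (perm_word s).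
  by rewrite size_perm_word; apply/allP => a; rewrite mem_perm_word => /andP[].
have vgt : all (leq 1) (perm_word t).
  by apply/allP => a; rewrite mem_perm_word => /andP[].
pose P (z : 'S_(size (parking_of_perm s) + size (parking_of_perm t))) :=
  shuffle z && C (shuffle_word z).
apply: (@eq_sum_image _ _ (fun u : parking => << u >>%R) _ _ P) => [z z' _ _ | x y _ _ | z | x].
- by move/(congr1 pf_word)/shuffle_word_inj; apply.
- exact: parking_of_perm_inj.
- case/andP => sz Cz; have [fu fv] := filter_shuffle_word uv_uniq ule vgt sz.
  have [x Ex] := perm_word_surj (perm_trans (perm_shuffle_word z) uv_iota).
  exists x; last exact/val_inj.
  rewrite Ex /is_shuffle Cz andbT; move: fu fv; rewrite su => -> ->.
  by rewrite !eqxx.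
- case/andP => /andP[/eqP fu /eqP fv] Cx.
  have [||z sz Ez] := @shuffle_word_surj _ _ uv_uniq ule vgt (perm_word x).
  + by rewrite su.
  + by rewrite su.
  exists z; last exact/val_inj.
  by rewrite /P sz Ez.
Qed.

End SumShuffles.

Lemma Theta_join (K : fieldType) (F G : oforest) (r : option 'I_(nvert F)) :
  (\sum_(x in S_forest (oforest_join G r)) << parking_of_perm x >> : {freeg parking / K})%R =
  (\sum_(s in S_forest F) \sum_(t in S_forest G)
    \sum_(x : 'S_(nvert F + nvert G) |
           is_shuffle s t (perm_word x) && graft_ext G r (perm_word x))
     << parking_of_perm x >>)%R.
Proof.
rewrite pair_big_dep /= pair_big_dep /=.
apply: (@eq_sum_image _ _ (fun u : parking => << u >>%R) _ _ _ _ (@parking_of_perm _)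
  (fun p : 'S_(nvert F) * 'S_(nvert G) * 'S_(nvert F + nvert G) =>
     parking_of_perm p.2)) => [x y _ _ | | x | ].
- exact: parking_of_perm_inj.
- move=> [[s t] x] [[s' t'] x'] /=.
  move=> /andP[_ /andP[/andP[/eqP a /eqP b] _]] /andP[_ /andP[/andP[/eqP a' /eqP b'] _]].
  move/parking_of_perm_inj => Ex; subst x'; congr (_, _, _).
    by apply: perm_word_inj; rewrite -a -a'.
  by apply: perm_word_inj; apply: (inj_map (@addIn (nvert F))); rewrite -b -b'.
- rewrite S_forestE => Hx.
  have EN : nvert (oforest_join G r) = nvert F + nvert G by [].
  have [s Es] : exists s : 'S_(nvert F),
      perm_word s = filter (fun a => a <= nvert F) (perm_word x).
    apply/perm_word_surj/uniq_perm; rewrite ?filter_uniq ?perm_word_uniq ?iota_uniq //.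
    by move=> a; rewrite mem_filter mem_perm_word mem_iota; lia.
  (* The subtraction is exact, since only letters above [nvert F] are kept. *)
  pose v := map (subn^~ (nvert F)) (filter (fun a => nvert F < a) (perm_word x)).
  have Ev : map (addn^~ (nvert F)) v = filter (fun a => nvert F < a) (perm_word x).
    rewrite -map_comp map_id_in // => a; rewrite mem_filter => /andP[Ha _] /=.
    exact: subnK (ltnW Ha).
  have [t Et] : exists t : 'S_(nvert G), perm_word t = v.
    apply/perm_word_surj/uniq_perm; rewrite ?iota_uniq //.
      rewrite -(map_inj_uniq (@addIn (nvert F))) Ev.
      by rewrite filter_uniq ?perm_word_uniq.
    move=> a; rewrite -(mem_map (@addIn (nvert F))) Ev.
    by rewrite mem_filter mem_perm_word mem_iota; lia.
  move: Ev; rewrite -Et => /esym Ev.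
  move: Hx; rewrite [lin_ext _ _](join_lin_ext G r (esym Es) Ev).
  case/and3P => HF HG Hr; exists (s, t, x) => //=.
  by rewrite !S_forestE HF HG Hr /is_shuffle Es Ev !eqxx.
move=> [[s t] x] /= /andP[/andP[Hs Ht] /andP[/andP[/eqP a /eqP b] Hg]].
exists x => //; rewrite S_forestE [lin_ext _ _](join_lin_ext G r a b).
by rewrite Hg -!S_forestE Hs Ht.
Qed.

(** * Admissible cuts and deconcatenation *)

Lemma mem_drop_index (T : eqType) (w : seq T) x k : uniq w -> x \in w ->
  (x \in drop k w) = (k <= index x w).
Proof.
move=> uw xw; rewrite leqNgt -(in_take _ xw).
move: uw xw; rewrite -{1 2}(cat_take_drop k w) cat_uniq mem_cat => /and3P[_ /hasPn H _].
by case: (boolP (x \in drop k w)) => [/H /negbTE -> //|_]; rewrite orbF => ->.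
Qed.

Section Cuts.
Variable F : oforest.
Local Notation n := (nvert F).
Implicit Types (A v : {set 'I_n}).

Definition down_closed A : bool :=
  [forall x, if parent F x is Some y then (y \in A) ==> (x \in A) else true].

Lemma down_closedP A :
  reflect (forall x y, parent F x = Some y -> y \in A -> x \in A) (down_closed A).
Proof.
apply: (iffP forallP) => H x; last by case E: (parent F x) => [y|//]; apply/implyP/H.
by move=> y E; have := H x; rewrite E => /implyP.
Qed.

(** The inverse of [Lea]: the admissible cut that produces a down-closed set. *)
Definition maximal_vertices A : {set 'I_n} :=
  [set x in A | if parent F x is Some y then y \notin A else true].

Lemma Lea_down_closed v : down_closed (Lea v).
Proof.
apply/down_closedP => x y Exy; rewrite !inE => /exists_inP[z zv yz].
apply/exists_inP; exists z => //; apply: connect_trans yz; apply: connect1.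
by rewrite /edge Exy.
Qed.

Lemma reaches_down_closed A x y : down_closed A -> reaches x y -> y \in A -> x \in A.
Proof.
move=> /down_closedP HA /connectP[p Hp ->].
by elim: p x Hp => //= a p IH x /andP[/eqP Exa /IH H] /H; apply: HA Exa.
Qed.

(** From a vertex of [A], climb to the parent while it stays in [A]; heights decrease, so a maximal
    vertex is reached. *)
Lemma Lea_maximal_vertices A : down_closed A -> Lea (maximal_vertices A) = A.
Proof.
move=> HA; apply/setP => x; rewrite inE; apply/exists_inP/idP => [[y]|].
  by rewrite inE => /andP[yA _] /reaches_down_closed; apply.
have [h Hh] := acyclic_height (parent_acyclic F).
elim: {x}(h x).+1 {-2}x (ltnSn (h x)) => // k IH x hx xA.
have top_x : (if parent F x is Some y then y \notin A else true) ->
    exists2 y, y \in maximal_vertices A & reaches x y.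
  by move=> Hx; exists x; rewrite ?inE ?xA //; apply: connect0.
case E: (parent F x) top_x => [y|]; last exact.
have [yA _|] := boolP (y \in A); last by move=> _; apply.
have exy : edge (parent F) x y by rewrite /edge E.
have [||z Hz yz] := IH y _ _ => //; first by have := Hh _ _ exy; lia.
by exists z => //; apply: connect_trans yz; apply: connect1.
Qed.

Lemma reaches_cases x y : reaches x y ->
  x = y \/ exists2 z, parent F x = Some z & reaches z y.
Proof.
move=> /connectP[[|z p] /= Hp ->]; [by left | right].
by case/andP: Hp => /eqP Ez Hp; exists z => //; apply/connectP; exists p.
Qed.

Lemma admissible_maximal_vertices A : down_closed A -> admissible_cut (maximal_vertices A).
Proof.
move=> HA; apply/forall_inP => x; rewrite inE => /andP[_ Hx].
apply/forall_inP => y; rewrite inE => /andP[yA _]; apply/implyP => xy.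
apply/negP => /reaches_cases[exy|[z Ez zy]]; first by rewrite exy eqxx in xy.
by move: Hx; rewrite Ez (reaches_down_closed HA zy yA).
Qed.

Lemma admissible_cutE v : admissible_cut v = (maximal_vertices (Lea v) == v).
Proof.
apply/idP/eqP => [/forall_inP Hv | <-]; last exact: admissible_maximal_vertices (Lea_down_closed v).
apply/setP => x; rewrite inE; apply/andP/idP => [[]|xv].
  rewrite inE => /exists_inP[y yv /reaches_cases[-> //|[z Ez zy]]].
  by rewrite Ez inE => /exists_inP []; exists y.
split; first by rewrite inE; apply/exists_inP; exists x => //; apply: connect0.
case Ez: (parent F x) => [z|//]; rewrite inE; apply/exists_inP => -[y yv zy].
have exz : edge (parent F) x z by rewrite /edge Ez.
have /forall_inP/(_ y yv)/implyP := Hv x xv.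
have xy : reaches x y by apply: connect_trans zy; apply: connect1.
(* Admissibility forces [x = y]; then the parent [z] of [x] leads back to [x], a cycle. *)
case: eqVneq => [Exy _|_ /(_ isT)]; last by rewrite xy.
have /'forall_forallP/(_ x z)/implyP/(_ exz) := parent_acyclic F.
by rewrite Exy -/(reaches z y) zy.
Qed.

Lemma sum_admissible_cuts (V : nmodType) (Q : pred {set 'I_n}) (f : {set 'I_n} -> V) :
  (\sum_(v | admissible_cut v && Q (Lea v)) f (Lea v) =
   \sum_(A | down_closed A && Q A) f A)%R.
Proof.
rewrite [RHS](reindex_onto (@Lea F) maximal_vertices) => [|A /andP[/Lea_maximal_vertices //]].
by apply: eq_bigl => v; rewrite Lea_down_closed admissible_cutE andbC.
Qed.

(** * Splitting words along a down-closed set of vertices *)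

Definition letters A : seq nat := [seq (val i).+1 | i <- enum A].

Lemma size_letters A : size (letters A) = #|A|.
Proof. by rewrite size_map -cardE. Qed.

Lemma letters_sorted A : sorted ltn (letters A).
Proof.
have tr : transitive (relpre (fun i : 'I_n => (val i).+1) ltn).
  by move=> a b c; apply: ltn_trans.
have ord_sorted : sorted (relpre (fun i : 'I_n => (val i).+1) ltn) (enum 'I_n).
  rewrite -sorted_map (map_comp succn val) val_enum_ord sorted_map.
  exact: iota_ltn_sorted.
by rewrite sorted_map; apply: sorted_filter => //; rewrite -enumT.
Qed.

Lemma letters_uniq A : uniq (letters A).
Proof. exact: sorted_uniq ltn_trans ltnn _ (letters_sorted A). Qed.

Lemma letters_positive A : positive (letters A).
Proof. by apply/allP => a /mapP[i _ ->]. Qed.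

Lemma mem_letters A (i : 'I_n) : (i.+1 \in letters A) = (i \in A).
Proof.
apply/mapP/idP => [[j Hj [/val_inj ->]]|Hi]; first by rewrite mem_enum in Hj.
by exists i; rewrite ?mem_enum.
Qed.

Lemma nth_letters A (a : 'I_#|A|) : nth 0 (letters A) a = (enum_val a).+1.
Proof.
by rewrite (nth_map (enum_default a)) -?cardE.
Qed.

Lemma index_expand_letters A (u : seq nat) (a : 'I_#|A|) : perm_eq u (iota 1 #|A|) ->
  index (enum_val a).+1 (expand (letters A) u) = index a.+1 u.
Proof.
move=> pu; rewrite -nth_letters expand_index ?size_letters //.
exact: letters_sorted.
Qed.

(** The complement comes first because parents precede their children. *)
Definition glue A (s : 'S_#|A|) (t : 'S_#|~: A|) : seq nat :=
  expand (letters (~: A)) (perm_word t) ++ expand (letters A) (perm_word s).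

Lemma perm_expand_letters A (s : 'S_#|A|) :
  perm_eq (expand (letters A) (perm_word s)) (letters A).
Proof. by rewrite perm_expand // size_letters perm_word_iota. Qed.

Lemma size_expand_letters A (s : 'S_#|A|) :
  size (expand (letters A) (perm_word s)) = #|A|.
Proof. by rewrite size_map size_perm_word. Qed.

Lemma parkize_expand_letters A (s : 'S_#|A|) :
  parkize (expand (letters A) (perm_word s)) = perm_word s.
Proof.
rewrite parkize_expand ?letters_sorted ?letters_positive //.
by rewrite size_letters perm_word_iota.
Qed.

Lemma letters_cat A : perm_eq (letters (~: A) ++ letters A) (iota 1 n).
Proof.
apply: uniq_perm; rewrite ?iota_uniq //.
  rewrite cat_uniq !letters_uniq andbT /=; apply/hasPn => a /mapP[i].
  by rewrite mem_enum => iA ->; rewrite mem_letters inE iA.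
move=> a; rewrite mem_cat mem_iota add1n ltnS.
apply/orP/andP => [[] /mapP[i _ ->]|[]]; rewrite ?ltn_ord //.
case: a => // a _ Ha; rewrite -[a]/(val (Ordinal Ha)) !mem_letters inE.
by apply/orP; rewrite orNb.
Qed.

Lemma perm_glue A (s : 'S_#|A|) (t : 'S_#|~: A|) : perm_eq (glue s t) (iota 1 n).
Proof.
apply: perm_trans (letters_cat A).
by rewrite perm_cat ?perm_expand_letters.
Qed.

Lemma sub_parentE A (a b : 'I_#|A|) :
  (sub_parent A a == Some b) = (parent F (enum_val a) == Some (enum_val b)).
Proof.
rewrite ffunE; case: pickP => [c /eqP ->|/(_ b)]; last by rewrite /edge => ->.
by apply/eqP/eqP => [[->] // | [/enum_val_inj ->]].
Qed.

(** Edges within [A] or within its complement are those of the two sub-forests. An edge leaving [A]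
    is respected by the order of concatenation, and none enters a down-closed [A]. *)
Lemma glue_lin_ext A (s : 'S_#|A|) (t : 'S_#|~: A|) : down_closed A ->
  lin_ext (parent F) (glue s t) =
  lin_ext (sub_parent A) (perm_word s) && lin_ext (sub_parent (~: A)) (perm_word t).
Proof.
move=> HA.
have iA (a : 'I_#|A|) : index (enum_val a).+1 (glue s t) = #|~: A| + index a.+1 (perm_word s).
  rewrite index_cat size_expand_letters (perm_mem (perm_expand_letters t)).
  by rewrite mem_letters inE enum_valP index_expand_letters ?perm_word_iota.
have iC (a : 'I_#|~: A|) : index (enum_val a).+1 (glue s t) = index a.+1 (perm_word t).
  rewrite index_cat (perm_mem (perm_expand_letters t)) mem_letters enum_valP.
  by rewrite index_expand_letters ?perm_word_iota.
apply/lin_extP/andP => [H|[/lin_extP Hs /lin_extP Ht] i j Eij].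
  split; apply/lin_extP => a b /eqP; rewrite sub_parentE => /eqP /H.
    by rewrite !iA leq_add2l.
  by rewrite !iC.
have [jA|jA] := boolP (j \in A).
  have iA' := down_closedP _ HA _ _ Eij jA.
  rewrite -(enum_rankK_in jA jA) -(enum_rankK_in iA' iA') !iA leq_add2l; apply: Hs.
  by apply/eqP; rewrite sub_parentE !enum_rankK_in // Eij.
have {}jA : j \in ~: A by rewrite inE.
have [iA'|iA'] := boolP (i \in A).
  rewrite -(enum_rankK_in jA jA) -(enum_rankK_in iA' iA') iA iC.
  apply: leq_trans (leq_addr _ _); apply: ltnW.
  by rewrite -[X in _ < X](size_perm_word t) index_mem mem_perm_word /=.
have {}iA' : i \in ~: A by rewrite inE.
rewrite -(enum_rankK_in jA jA) -(enum_rankK_in iA' iA') !iC; apply: Ht.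
by apply/eqP; rewrite sub_parentE !enum_rankK_in // Eij.
Qed.

Definition dropset k (w : seq nat) : {set 'I_n} := [set i : 'I_n | i.+1 \in drop k w].

Lemma dropset_down_closed k (s : 'S_n) : s \in S_forest F ->
  down_closed (dropset k (perm_word s)).
Proof.
rewrite S_forestE => /lin_extP Hs; apply/down_closedP => x y /Hs.
by rewrite !inE !mem_drop_index ?perm_word_uniq ?mem_perm_word //= => H /leq_trans; apply.
Qed.

Lemma perm_drop_letters k (s : 'S_n) :
  perm_eq (drop k (perm_word s)) (letters (dropset k (perm_word s))).
Proof.
apply: uniq_perm; rewrite ?drop_uniq ?perm_word_uniq ?letters_uniq // => a.
apply/idP/mapP => [ad|[i]]; last by rewrite mem_enum inE => Hi ->.
have := mem_drop ad; rewrite mem_perm_word; case: a ad => // a ad /= Ha.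
by exists (Ordinal Ha); rewrite ?mem_enum ?inE.
Qed.

Lemma card_dropset k (s : 'S_n) : #|dropset k (perm_word s)| = n - k.
Proof.
by rewrite -size_letters -(perm_size (perm_drop_letters k s)) size_drop size_perm_word.
Qed.

Lemma dropset_glueP A (k : 'I_n.+1) (s : 'S_n) : dropset k (perm_word s) = A ->
  k = #|~: A| :> nat /\ exists s1 t1, perm_word s = @glue A s1 t1.
Proof.
move=> EA.
(* The suffix has [n - k] letters, which determines [k] because [k <= n]. *)
have Ek : k = #|~: A| :> nat.
  by have := cardsC A; rewrite -{1}EA card_dropset card_ord; have := ltn_ord k; lia.
split=> //.
have pd : perm_eq (drop k (perm_word s)) (letters A) by rewrite -EA perm_drop_letters.
have pt : perm_eq (take k (perm_word s)) (letters (~: A)).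
  rewrite -(perm_cat2r (letters A)) perm_sym; apply: perm_trans (letters_cat A) _.
  rewrite perm_sym; apply: perm_trans (perm_word_iota s).
  by rewrite -[X in perm_eq _ X](cat_take_drop k) perm_cat2l perm_sym.
have [u] := expand_surj (letters_sorted A) pd; rewrite size_letters => /perm_word_surj[s1 <-] Es.
have [u'] := expand_surj (letters_sorted _) pt; rewrite size_letters => /perm_word_surj[t1 <-] Et.
by exists s1, t1; rewrite /glue Es Et cat_take_drop.
Qed.

Lemma dropset_glue A (s1 : 'S_#|A|) (t1 : 'S_#|~: A|) : dropset #|~: A| (glue s1 t1) = A.
Proof.
apply/setP => i; rewrite inE drop_size_cat ?size_expand_letters //.
by rewrite (perm_mem (perm_expand_letters s1)) mem_letters.
Qed.

Lemma deconcat_glue A (s : 'S_n) (s1 : 'S_#|A|) (t1 : 'S_#|~: A|) :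
  perm_word s = glue s1 t1 ->
  (park_drop (parking_of_perm s) #|~: A|, park_take (parking_of_perm s) #|~: A|) =
  (parking_of_perm s1, parking_of_perm t1).
Proof.
move=> E; congr (_, _); apply: val_inj => /=; rewrite E.
  by rewrite drop_size_cat ?size_expand_letters ?parkize_expand_letters.
by rewrite take_size_cat ?size_expand_letters ?parkize_expand_letters.
Qed.

(** Distinct words may have equal standardized pieces, but not once [A] is fixed: the pieces and [A]
    then rebuild the word. *)
Lemma sum_deconcat_dropset (K : fieldType) A : down_closed A ->
  (\sum_(p : 'S_n * 'I_n.+1 |
       (p.1 \in S_forest F) && (dropset p.2 (perm_word p.1) == A))
     << (park_drop (parking_of_perm p.1) p.2, park_take (parking_of_perm p.1) p.2) >> =
   \sum_(s in S_forest (sub_forest A)) \sum_(t in S_forest (sub_forest (~: A)))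
     << (parking_of_perm s, parking_of_perm t) >>
     :> {freeg (parking * parking)%type / K})%R.
Proof.
move=> HA; rewrite pair_big_dep /=.
pose f (p : 'S_n * 'I_n.+1) :=
  (park_drop (parking_of_perm p.1) p.2, park_take (parking_of_perm p.1) p.2).
apply: (@eq_sum_image _ _ (fun q : parking * parking => << q >>%R) _ _ _ _ f
  (fun q : 'S_#|A| * 'S_#|~: A| => (parking_of_perm q.1, parking_of_perm q.2))).
- move=> [s k] [s' k']; rewrite /in_mem /= => /andP[_ /eqP/dropset_glueP[Ek [s1 [t1 E]]]].
  case/andP=> _ /eqP/dropset_glueP[Ek' [s1' [t1' E']]].
  rewrite /f /= Ek Ek' (deconcat_glue E) (deconcat_glue E').
  case=> e1 e2; congr (_, _); last by apply: val_inj; rewrite /= Ek.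
  apply: perm_word_inj; rewrite E E'.
  by rewrite (perm_word_inj e1) (perm_word_inj e2).
- by move=> [s t] [s' t'] _ _ [/perm_word_inj -> /perm_word_inj ->].
- move=> [s k] /= /andP[Hs /eqP/dropset_glueP[Ek [s1 [t1 E]]]].
  exists (s1, t1); last by rewrite /f /= Ek (deconcat_glue E).
  by move: Hs; rewrite !S_forestE E glue_lin_ext.
- move=> [s1 t1] /= Hst; have [s E] := perm_word_surj (perm_glue s1 t1).
  have kn : #|~: A| < n.+1 by rewrite ltnS -[X in _ <= X]card_ord max_card.
  exists (s, Ordinal kn); last by rewrite /f /= (deconcat_glue E).
  by rewrite /= E dropset_glue eqxx andbT S_forestE E glue_lin_ext //;
     move: Hst; rewrite !S_forestE.
Qed.

End Cuts.

(** * Compatibility of Theta with the operations *)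

(** A shuffle keeps the letters of the shifted [t] in order, so all of them follow the letter [n] as
    soon as the first one does. *)
Lemma nwarrow_shuffleE n m (s : 'S_n) (t : 'S_m)
    (z : 'S_(size (parking_of_perm s) + size (parking_of_perm t))) :
    0 < n -> 0 < m -> shuffle z ->
  (letter (perm_word z) (max_pos (parking_of_perm s))
     <= letter (perm_word z) (size (parking_of_perm s)).+1) =
  [forall b : 'I_m, index n (shuffle_word z) <= index (n + b).+1 (shuffle_word z)].
Proof.
move=> n0 m0 /'forall_forallP Hz; rewrite max_pos_perm_word // /letter /=.
have uv_uniq : uniq (shifted_cat (perm_word s) (perm_word t)).
  by rewrite (perm_uniq (shifted_cat_perm_word s t)) iota_uniq.
have szs : size (parking_of_perm s) = n := size_perm_word s.
have szt : size (parking_of_perm t) = m := size_perm_word t.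
have ns : n \in perm_word s by rewrite mem_perm_word n0 leqnn.
have Hin : index n (perm_word s) < size (parking_of_perm s) by rewrite index_mem.
have Hi : index n (perm_word s) < size (parking_of_perm s) + size (parking_of_perm t).
  exact: leq_trans Hin (leq_addr _ _).
have Hj j : j < m -> n + j < size (parking_of_perm s) + size (parking_of_perm t).
  by rewrite szs szt ltn_add2l.
have H0 : size (perm_word s) < size (parking_of_perm s) + size (parking_of_perm t).
  by rewrite szs szt -[X in X < _]addn0 ltn_add2l.
rewrite (nth_perm_word z (Ordinal Hi)) (nth_perm_word z (Ordinal H0)) ltnS.
have Ei : z (Ordinal Hi) = index n (shuffle_word z) :> nat.
  by rewrite -(index_shuffle_word uv_uniq) nth_cat Hin nth_index.
have Ej j (jm : j < m) :
    z (Ordinal (Hj j jm)) = index (n + t (Ordinal jm)).+1 (shuffle_word z) :> nat.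
  rewrite -(index_shuffle_word uv_uniq) nth_cat /= size_perm_word ltnNge leq_addr /= addKn.
  by rewrite (nth_map 0) ?size_perm_word // (nth_perm_word t (Ordinal jm)) addSn addnC.
have E0 : Ordinal H0 = Ordinal (Hj 0 m0) by apply: val_inj; rewrite /= size_perm_word addn0.
rewrite E0 Ei; apply/idP/forallP => [H b | /(_ (t (Ordinal m0)))]; last by rewrite Ej.
apply: leq_trans H _; set j := (t^-1)%g b.
have -> : b = t (Ordinal (ltn_ord j)).
  by rewrite -[LHS](permKV t); congr (t _); apply: val_inj.
rewrite -Ej; have [j0|j0] := posnP j.
  by rewrite leq_eqVlt; apply/orP/or_introl/eqP; congr (val (z _)); apply: val_inj; rewrite /= j0.
have /implyP := Hz (Ordinal (Hj 0 m0)) (Ordinal (Hj j (ltn_ord j))).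
by move=> Hzz; apply/ltnW/Hzz; rewrite /= szs ltn_add2l j0 leq_addr orbT.
Qed.

Section Theta.
Variable K : fieldType.
Local Open Scope ring_scope.

Definition Theta_forest (F : oforest) : {freeg parking / K} :=
  \sum_(s in S_forest F) << parking_of_perm s >>.

Lemma ThetaU F : @Theta K << F >> = Theta_forest F.
Proof. exact: fgliftU. Qed.

Lemma Theta_disjoint_union (F G : oforest) :
  Theta_forest (disjoint_union F G) =
  bilift (@parking_mul K) (Theta_forest F) (Theta_forest G).
Proof.
rewrite bilift_sum [LHS]Theta_join; apply: eq_bigr => s _; apply: eq_bigr => t _.
rewrite -(sum_shuffles K s t (@graft_ext F G None)).
by apply: eq_bigl => z; rewrite andbT.
Qed.

Lemma Theta_graft (F G : oforest) : (0 < nvert F)%N -> (0 < nvert G)%N ->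
  Theta_forest (graft F G) =
  bilift (@parking_nwarrow K) (Theta_forest F) (Theta_forest G).
Proof.
move=> F0 G0; rewrite bilift_sum [LHS]Theta_join; apply: eq_bigr => s _; apply: eq_bigr => t _.
rewrite -(sum_shuffles K s t (@graft_ext F G (greatest F))).
have [g Eg gn] := greatestP F0.
apply: eq_bigl => z; case: (boolP (shuffle z)) => // Hz.
by rewrite nwarrow_shuffleE // /graft_ext Eg gn.
Qed.

(** Pairs of a linear extension and a cut position are grouped by the set of last letters. The
    positions 0 and [nvert F] are included; [Q] excludes them when needed. *)
Lemma Theta_cuts (F : oforest) (Q : pred {set 'I_(nvert F)}) :
  \sum_(v | admissible_cut v && Q (Lea v))
     tensor (Theta_forest (sub_forest (Lea v))) (Theta_forest (sub_forest (Roo v))) =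
  \sum_(s in S_forest F) \sum_(k < (nvert F).+1 | Q (dropset F k (perm_word s)))
     << (park_drop (parking_of_perm s) k, park_take (parking_of_perm s) k) >>.
Proof.
rewrite (sum_admissible_cuts Q (fun A =>
  tensor (Theta_forest (sub_forest A)) (Theta_forest (sub_forest (~: A))))).
rewrite pair_big_dep /=.
rewrite (partition_big (fun p : 'S_(nvert F) * 'I_(nvert F).+1 =>
    dropset F p.2 (perm_word p.1)) (fun A => down_closed A && Q A)) /=.
  apply: eq_bigr => A /andP[HA QA]; rewrite /tensor bilift_sum -sum_deconcat_dropset //.
  apply: eq_bigl => p; rewrite -andbA; congr (_ && _).
  by case: eqP => [->|]; rewrite ?QA ?andbF.
by move=> [s k] /= /andP[/(dropset_down_closed k) -> ->].
Qed.

(** As [A] has [nvert F - k] elements, non-emptiness of [A] and of its complement means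
    [0 < k < nvert F]; the greatest vertex lies in [A] iff its letter occurs after position [k]. *)
Lemma dropset_Lea_Roo (F : oforest) (k : 'I_(nvert F).+1) (s : 'S_(nvert F)) : (0 < nvert F)%N ->
  let A := @dropset F k (perm_word s) in
  [&& A != set0, ~: A != set0 & has_greatest A] = (1 <= k < max_pos (perm_word s))%N /\
  [&& A != set0, ~: A != set0 & has_greatest (~: A)] =
    (max_pos (perm_word s) <= k < nvert F)%N.
Proof.
move=> F0 A; have [g Eg gn] := greatestP F0.
have ns : nvert F \in perm_word s by rewrite mem_perm_word F0 leqnn.
have := card_dropset k s; have := cardsC A; rewrite card_ord -/A => EC EA.
have := ltn_ord k; rewrite /has_greatest Eg -!card_gt0 in_setC.
have -> : g \in A = (k < max_pos (perm_word s))%N.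
  by rewrite inE gn mem_drop_index ?perm_word_uniq // max_pos_perm_word // ltnS.
have : (max_pos (perm_word s) <= nvert F)%N.
  by rewrite max_pos_perm_word // -[X in (_ < X)%N](size_perm_word s) index_mem.
have : (0 < max_pos (perm_word s))%N by rewrite max_pos_perm_word.
lia.
Qed.

Lemma sum_nat_ord (V : nmodType) (f : nat -> V) a b n : (b <= n)%N ->
  \sum_(a <= k < b) f k = \sum_(k < n | (a <= k < b)%N) f k.
Proof. by move=> bn; rewrite big_geq_mkord (big_ord_widen_cond n (leq a) f bn). Qed.

Lemma Theta_prec (F : oforest) : (0 < nvert F)%N ->
  tensor_map (@Theta K) (@Theta K) (@oforest_prec K F) =
  fglift (@parking_prec K) (Theta_forest F).
Proof.
move=> F0; rewrite /tensor_map !linear_sum /=.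
under eq_bigr do rewrite fgliftU !ThetaU.
rewrite (Theta_cuts (fun A => [&& A != set0, ~: A != set0 & has_greatest A])).
apply: eq_bigr => s _; rewrite fgliftU /parking_prec.
rewrite (@sum_nat_ord _ _ _ _ (nvert F).+1); last first.
  by rewrite max_pos_perm_word // ltnS -[X in (_ <= X)%N](size_perm_word s) index_size.
by apply: eq_bigl => k; have [] := dropset_Lea_Roo k s F0.
Qed.

Lemma Theta_succ (F : oforest) : (0 < nvert F)%N ->
  tensor_map (@Theta K) (@Theta K) (@oforest_succ K F) =
  fglift (@parking_succ K) (Theta_forest F).
Proof.
move=> F0; rewrite /tensor_map !linear_sum /=.
under eq_bigr do rewrite fgliftU !ThetaU.
rewrite (Theta_cuts (fun A => [&& A != set0, ~: A != set0 & has_greatest (~: A)])).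
apply: eq_bigr => s _; rewrite fgliftU /parking_succ.
rewrite (@sum_nat_ord _ _ _ _ (nvert F).+1) /= ?size_perm_word //.
by apply: eq_bigl => k; have [] := dropset_Lea_Roo k s F0.
Qed.

End Theta.

Theorem proposition26 (K : fieldType) :
  @dupDend_morphism K (Ho K) (PQSym_cop K) (@Theta K).
Proof.
split.
- exact: linearP.
(* Every word in the image of a basis forest has as many letters as the forest has vertices. *)
- move=> x Hx b; rewrite /Theta fglift_dom => /dom_sum_subset /flattenP[d].
  move=> /mapP[F]; rewrite mem_filter => /Hx F0 -> /domZ_subset.
  move=> /dom_sum_subset /flattenP[d'] /mapP[s _ ->].
  by rewrite domU1 inE => /eqP -> /=; rewrite size_perm_word.
- move=> x y Hx Hy; rewrite /ddmul /Theta linear_bilift bilift_fglift.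
  apply: eq_in_bilift => F G _ _ /=; rewrite fgliftU.
  exact: Theta_disjoint_union.
- move=> x y Hx Hy; rewrite /nwarrow /Theta linear_bilift bilift_fglift.
  apply: eq_in_bilift => F G /Hx F0 /Hy G0 /=; rewrite fgliftU.
  exact: Theta_graft.
- move=> x Hx; rewrite /Delta_prec /Theta [LHS]linear_fglift [RHS]linear_fglift.
  apply: eq_in_fglift => F /Hx; exact: Theta_prec.
- move=> x Hx; rewrite /Delta_succ /Theta [LHS]linear_fglift [RHS]linear_fglift.
  apply: eq_in_fglift => F /Hx; exact: Theta_succ.
Qed.
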